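(* Let $\mathcal{G}$ be a weighted directed ring on $n\geq 2$ nodes with edges labelled so that $e_i$ is the unique edge pointing towards $v_i$, with positive weight $a_i$, and let $B\in\mathbb{R}^{n\times n}$ be its incidence matrix. For $i=1,\dots,n$ let $g_i:\mathbb{R}\to\mathbb{R}$ be an increasing (not necessarily continuous, not necessarily strictly increasing) function with $\lim_{y\to\infty}|g_i(y)|=\infty$. Consider the system $$\dot x=[a_1g_1(B_{\cdot,1}^\top x),\dots,a_ng_n(B_{\cdot,n}^\top x)]^\top,$$ i.e. $\dot x_i=a_i\,g_i(x_{p(i)}-x_i)$, where $v_{p(i)}$ is the unique node with an edge to $v_i$. Suppose that either 1) $n=2$ and $g_i$ is odd for every edge $e_i$; or 2) $n\geq 3$, $g_i(0)=0$ for every edge $e_i$, and there exists an edge $e_i$ such that $\mathcal{F}[g_i](0)=\{0\}$. Then every Filippov solution $x:[0,\infty)\to\mathbb{R}^n$ of this system converges asymptotically (as $t\to\infty$, in the sense that its distance to the set tends to $0$) to the set $$\mathcal{H}_2=\{x\in\mathbb{R}^n\mid 0\in\mathcal{F}[g_i](B_{\cdot,i}^\top x)\ \text{for all } i=1,\dots,n\}.$$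
   Context: A directed ring is a digraph on nodes $v_1,\dots,v_n$ consisting of a single directed cycle through all nodes, so every node has exactly one outgoing and exactly one incoming edge. Incidence matrix $B$: the $(j,k)$ entry is $1$ if the edge $e_k$ originates from $v_j$, $-1$ if it points towards $v_j$, and $0$ otherwise; $B_{\cdot,k}$ is the $k$-th column. A function $g$ is odd if $g(y)=-g(-y)$ for all $y$. For a map $X:\mathbb{R}^p\to\mathbb{R}^p$ the Filippov set-valued map is $\mathcal{F}[X](x)=\bigcap_{\delta>0}\bigcap_{\mu(S)=0}\overline{\mathrm{co}}\{X(B(x,\delta)\setminus S)\}$, where here $B(x,\delta)$ is the open ball, $\mu$ is Lebesgue measure and $\overline{\mathrm{co}}$ is the closed convex hull. A Filippov solution of $\dot x=X(x)$ is a (locally) absolutely continuous function $x(t)$ with $\dot x(t)\in\mathcal{F}[X](x(t))$ for almost every $t$. *)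

(* Defs.v *)
From HB Require Import structures.
From mathcomp Require Import all_boot all_order all_algebra.
From mathcomp Require Import all_classical all_reals all_analysis.

Set Implicit Arguments.
Unset Strict Implicit.
Unset Printing Implicit Defensive.

Import Order.TTheory GRing.Theory Num.Theory.
Import numFieldNormedType.Exports.

Local Open Scope classical_set_scope.
Local Open Scope ring_scope.

Record digraph (n m : nat) := Digraph {
  edge_tail : 'I_m -> 'I_n;
  edge_head : 'I_m -> 'I_n
}.

(* A cyclic enumeration of the edges, each one starting where the previous one
   ends, that uses every edge once and leaves every node once. *)
Definition directed_ring n m (G : digraph n m) : Prop :=
  exists s : seq 'I_m,
    [/\ cycle (fun e f => edge_head G e == edge_tail G f) s,
        perm_eq s (enum 'I_m) &
        perm_eq [seq edge_tail G e | e <- s] (enum 'I_n)].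

Definition incidence (R : realType) n m (G : digraph n m) : 'M[R]_(n, m) :=
  \matrix_(j, k) (if edge_tail G k == j then 1
                  else if edge_head G k == j then -1 else 0).

(* The library norm on matrices is the maximum norm; vectors of R^p are
   measured here with the Euclidean one. *)
Definition enorm (R : realType) p (v : 'cV[R]_p) : R :=
  Num.sqrt (\sum_(i < p) v i 0 ^+ 2).

Definition eball (R : realType) p (x : 'cV[R]_p) (d : R) : set 'cV[R]_p :=
  [set y | enorm (y - x) < d].

Definition box (R : realType) p (l u : 'cV[R]_p) : set 'cV[R]_p :=
  [set x | forall i, l i 0 <= x i 0 <= u i 0].

(* The p-dimensional Lebesgue outer measure. A set has Lebesgue measure zero
   (and is then Lebesgue measurable) iff its outer measure is zero. *)
Definition lebesgue_outer (R : realType) p (S : set 'cV[R]_p) : \bar R :=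
  ereal_inf [set z | exists l u : nat -> 'cV[R]_p,
    [/\ forall k i, l k i 0 <= u k i 0,
        S `<=` \bigcup_k box (l k) (u k) &
        z = (\sum_(0 <= k <oo) (\prod_(i < p) (u k i 0 - l k i 0))%:E)%E]].

Definition closed_convex_hull (R : realType) p (A : set 'cV[R]_p) :
    set 'cV[R]_p :=
  smallest [set C : set 'cV[R]_p |
    closed C /\ convex_set (M := 'cV[R]_p) C] A.

Definition filippov (R : realType) p (X : 'cV[R]_p -> 'cV[R]_p)
    (x : 'cV[R]_p) : set 'cV[R]_p :=
  \bigcap_(d in [set d : R | 0 < d])
    \bigcap_(S in [set S : set 'cV[R]_p | lebesgue_outer S = 0%E])
      closed_convex_hull (X @` (eball x d `\` S)).

(* The case p = 1, with R identified with 'cV[R]_1. *)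
Definition filippov1 (R : realType) (g : R -> R) (y : R) : set R :=
  [set z | filippov (fun v : 'cV[R]_1 => (g (v 0 0))%:M) y%:M z%:M].

Definition abs_continuous_on (R : realType) p (a b : R) (x : R -> 'cV[R]_p) :
    Prop :=
  forall e : R, 0 < e -> exists2 d : R, 0 < d &
    forall (m : nat) (u v : 'I_m -> R),
      (forall k, [/\ a <= u k, u k <= v k & v k <= b]) ->
      trivIset setT (fun k => `]u k, v k[%classic) ->
      \sum_(k < m) (v k - u k) < d ->
      \sum_(k < m) enorm (x (v k) - x (u k)) < e.

(* Solutions on [0, +oo[; values of [x] at negative times are irrelevant. *)
Definition filippov_solution (R : realType) p (X : 'cV[R]_p -> 'cV[R]_p)
    (x : R -> 'cV[R]_p) : Prop :=
  (forall T : R, 0 <= T -> abs_continuous_on 0 T x) /\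
  {ae @lebesgue_measure R, forall t : R, 0 <= t ->
     derivable x t 1 /\ filippov X (x t) (derive1 x t)}.

(* The distance to the empty set is [+oo]. *)
Definition edist_to (R : realType) p (A : set 'cV[R]_p) (x : 'cV[R]_p) :
    \bar R :=
  ereal_inf [set (enorm (x - y))%:E | y in A].

Definition converges_to_set (R : realType) p (x : R -> 'cV[R]_p)
    (A : set 'cV[R]_p) : Prop :=
  edist_to A (x t) @[t --> +oo] --> 0%E.

Definition edge_diff (R : realType) n m (G : digraph n m) (k : 'I_m)
    (x : 'cV[R]_n) : R :=
  ((col k (incidence R G))^T *m x) 0 0.

Definition ring_system (R : realType) n (G : digraph n n) (a : 'I_n -> R)
    (g : 'I_n -> R -> R) (x : 'cV[R]_n) : 'cV[R]_n :=
  \col_i (a i * g i (edge_diff G i x)).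

Definition H2 (R : realType) n m (G : digraph n m) (g : 'I_m -> R -> R) :
    set 'cV[R]_n :=
  [set x | forall i, filippov1 (g i) (edge_diff G i x) 0].

(* Main.v *)
(* Write p(i) for the predecessor of i and G_i = a_i g_i, so that x_i' lies in
   [G_i(y_i-), G_i(y_i+)] with y_i = x_p(i) - x_i.

   For n >= 3 the maximum of the coordinates does not increase and the minimum
   does not decrease: an extremal node with a non-extremal predecessor is
   pushed inwards, and at consensus the special edge forces velocity 0.
   Suppose some G_i vanishes at a z > 0. Then some coordinate converges, since
   otherwise all of them would end up bounded away from the limit of the
   maximum. Convergence passes from x_p(i) to x_i, which stays above or below
   the limit of x_p(i) while approaching it monotonically, or converges to it.
   So x converges, and its limit is in H2, for otherwise some coordinate would
   have a velocity bounded away from 0. If instead every G_i is positive on the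
   positive axis, then after the reflection x |-> - x a node near the limit of
   the maximum has a predecessor near it too, and going around the ring all
   coordinates have the same limit.

   For n = 2 the distance |x_1 - x_2| does not increase, and both g_i are
   nonpositive below its limit. *)

Require Import Defs.
From HB Require Import structures.
From mathcomp Require Import all_boot all_order all_algebra.
From mathcomp Require Import all_classical all_reals all_analysis.
From mathcomp Require Import ring lra.
Set Implicit Arguments.
Unset Strict Implicit.
Unset Printing Implicit Defensive.
Import Order.TTheory GRing.Theory Num.Theory.
Import numFieldNormedType.Exports.
Local Open Scope classical_set_scope.
Local Open Scope ring_scope.

(** * Monotonicity of absolutely continuous functions *)

(** Families are lists ordered from left to right, so that an argument moving down from the right
    end can put one more interval in front. *)
Definition intervals (R : realType) (a b : R) (l : seq (R * R)) : bool :=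
  all (fun q => [&& a <= q.1, q.1 <= q.2 & q.2 <= b]) l
  && pairwise (fun p q : R * R => p.2 <= q.1) l.

Definition abs_continuous (R : realType) (a b : R) (f : R -> R) : Prop :=
  forall e : R, 0 < e -> exists2 d : R, 0 < d &
    forall l, intervals a b l -> \sum_(q <- l) (q.2 - q.1) < d ->
      \sum_(q <- l) `|f q.2 - f q.1| < e.

(* Slopes are taken from the left because the left slope of a maximum is the
   least slope among the active functions: to see that the maximum does not
   grow, it is enough to exhibit one active function that does not. *)
Definition left_slope_le (R : realType) (f : R -> R) (r k : R) : Prop :=
  forall e : R, 0 < e -> exists2 d : R, 0 < d &
    forall h, 0 < h < d -> f r - f (r - h) <= (k + e) * h.

Lemma intervals_cons (R : realType) (a b : R) q l :
  intervals a b (q :: l) =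
  [&& a <= q.1, q.1 <= q.2, q.2 <= b & intervals q.2 b l].
Proof.
rewrite /intervals /=; apply/idP/idP.
  move=> /andP[/andP[/and3P[-> -> ->] /allP H] /andP[/allP H2 ->]] /=.
  rewrite andbT; apply/allP => p pl; have /and3P[_ -> ->] := H p pl.
  by rewrite (H2 p pl).
move=> /and4P[aq qq -> /andP[/allP H ->]] /=.
rewrite aq qq !andbT /=; apply/andP; split; apply/allP => p pl;
  have /and3P[h1 h2 h3] := H p pl => //.
by rewrite h2 h3 (le_trans aq) // (le_trans qq).
Qed.

Lemma intervals_widen (R : realType) (a b a' b' : R) l :
  a' <= a -> b <= b' -> intervals a b l -> intervals a' b' l.
Proof.
move=> aa bb /andP[/allP H pw]; rewrite /intervals pw andbT.
apply/allP => p /H /and3P[h1 -> h3] /=.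
by rewrite (le_trans aa) //= (le_trans h3).
Qed.

(** Half-open intervals that touch are still disjoint, so the first one can be split off and the
    rest measured inside [U] to the right of it. *)
Lemma sum_length_le_measure (R : realType) (U : set R) (a b : R) l :
  measurable U -> intervals a b l ->
  (forall q, q \in l -> `[q.1, q.2[ `<=` U) ->
  ((\sum_(q <- l) (q.2 - q.1))%:E <= lebesgue_measure (U `&` `[a, b[))%E.
Proof.
move=> mU; elim: l a => [|q l IH] a; first by rewrite big_nil.
rewrite intervals_cons big_cons => /and4P[aq qq qb H] sub.
have mI : measurable (U `&` `[q.2, b[) by apply: measurableI.
apply: (@le_trans _ _
  (lebesgue_measure (`[q.1, q.2[%classic `|` (U `&` `[q.2, b[)))%E).
  rewrite measureU //; last first.
    apply/seteqP; split=> // z /= [];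
      rewrite !in_itv /= => /andP[_ h] [_ /andP[h2 _]].
    by move: h; rewrite ltNge h2.
  rewrite EFinD; apply: leeD; last by apply: IH => // p pl; apply: sub;
    rewrite inE pl orbT.
  have -> : (q.2 - q.1)%:E = lebesgue_measure (`[q.1, q.2[%classic : set R);
    last by [].
  rewrite lebesgue_measure_itv /= lte_fin; case: ltP => // h.
  by congr (_%:E); apply/eqP; rewrite subr_eq0 eq_le h qq.
apply: le_measure; rewrite ?inE //; first exact: measurableU.
  by apply: measurableI.
move=> z /= [zq|[zU]].
  split; first by apply: (sub q) => //; rewrite inE eqxx.
  by move: zq; rewrite !in_itv /= => /andP[h1 h2];
    rewrite (le_trans aq) //= (lt_le_trans h2).
rewrite !in_itv /= => /andP[h1 h2]; split=> //; rewrite h2 andbT.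
by rewrite (le_trans aq) // (le_trans qq).
Qed.

(** Outer regularity makes [U] minus a measurable null cover of [N] small, and adding the null cover
    back costs nothing. *)
Lemma negligible_open_cover (R : realType) (N : set R) (d : R) :
  (@lebesgue_measure R).-negligible N -> 0 < d ->
  exists U : set R, [/\ open U, N `<=` U & (lebesgue_measure U < d%:E)%E].
Proof.
move=> [A [mA' A0' NA]] d0.
have mA : measurable (A : set R) := mA'.
have A0 : lebesgue_measure (A : set R) = 0%E := A0'.
have [|U [oU AU Ud]] := lebesgue_regularity_outer mA _ d0.
  exact: (eq_ind_r (fun z => (z < +oo)%E) (ltry 0) A0).
exists U; split=> //; first exact: subset_trans AU.
have -> : U = (U `\` A) `|` A.
  by rewrite setUC setDUK.
apply: le_lt_trans Ud; rewrite -[leRHS]adde0 -[X in (_ <= _ + X)%E]A0.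
apply: measureU2 => //; apply: measurableD => //;
  exact: measurable_realfun.open_measurable.
Qed.

Lemma abs_continuous_near (R : realType) (a b : R) f (e : R) :
  abs_continuous a b f -> 0 < e -> exists2 d, 0 < d &
    forall u v, a <= u -> u <= v -> v <= b -> v - u < d -> `|f v - f u| < e.
Proof.
move=> H e0; have [d d0 Hd] := H e e0; exists d => // u v au uv vb uvd.
have := Hd [:: (u, v)]; rewrite /intervals /= !big_seq1 /= au uv vb; exact.
Qed.

(* Cover N by an open set U so small that f varies by less than e on any finite
   family of disjoint intervals inside U. Moving down from t, outside N the
   slope bound advances the estimate, and inside N an interval of U does. *)
Lemma left_slope_nonincreasing (R : realType) (N : set R) (s t : R) f :
  (@lebesgue_measure R).-negligible N -> s <= t -> abs_continuous s t f ->
  (forall r, s < r <= t -> ~ N r -> left_slope_le f r 0) -> f t <= f s.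
Proof.
move=> N0 st acf slope.
suff key e : 0 < e -> f t - f s <= e * (t - s) + e + e.
  (* The errors in [key] add up to [e * c], hence the rescaling. *)
  apply/ler_addgt0Pr => e e0; pose c := t - s + (1 + 1).
  have c0 : 0 < c by rewrite /c; lra.
  have := key (e / c) (divr_gt0 e0 c0).
  rewrite -addrA -[X in _ <= _ + (X + X)]mulr1 -!mulrDr -/c mulfVK ?gt_eqF //;
    lra.
move=> e0; have [d d0 Hd] := acf _ e0.
have [U [oU NU mud]] := negligible_open_cover N0 d0.
pose inU (l : seq (R * R)) := forall q, q \in l -> `[q.1, q.2[ `<=` U.
pose V (l : seq (R * R)) := \sum_(q <- l) `|f q.2 - f q.1|.
(* The slack [e1] lets the estimate pass to an infimum by continuity; what follows is a downward
   induction on the reals from [t] to [s]. *)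
pose G r := forall e1, 0 < e1 -> exists l,
  [/\ intervals r t l, inU l & f t - f r <= e * (t - r) + V l + e1].
suff /(_ e e0) [l [il lU le]] : G s.
  have : V l < e; last by lra.
  apply: Hd => //; rewrite -lte_fin; apply: le_lt_trans mud.
  apply: le_trans (sum_length_le_measure _ il lU) _;
    first exact: measurable_realfun.open_measurable.
  apply: le_measure; rewrite ?inE;
    [|exact: measurable_realfun.open_measurable|by apply: subIsetl].
  by apply: measurableI => //; exact: measurable_realfun.open_measurable.

have Gt : G t.
  by move=> e1 e10; exists [::]; split; rewrite // /V big_nil; nra.
pose S := [set r | s <= r <= t /\ G r].
have hS : has_inf S.
  by split; [exists t; split; rewrite ?st ?lexx|exists s => r [/andP[]]].
pose r0 := inf S.
have sr0 : s <= r0 by apply: lb_le_inf; [case: hS|move=> r [/andP[]]].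
have r0t : r0 <= t by apply: ge_inf; [case: hS|split; rewrite ?st ?lexx].
have Gr0 : G r0.
  move=> e1 e10; have e20 : 0 < e1 / 2 by lra.
  have [d1 d10 H1] := abs_continuous_near acf e20.
  have [r [/andP[sr rt] Gr] rr0] := inf_adherent d10 hS.
  have r0r : r0 <= r by apply: ge_inf; [case: hS|split; rewrite ?sr ?rt].
  have [l [il lU le]] := Gr _ e20.
  exists l; split=> //; first exact: intervals_widen il.
  have : `|f r - f r0| < e1 / 2 by apply: H1 => //; rewrite -/r0 in rr0; lra.
  by rewrite ltr_norml => /andP[h1 h2]; nra.
have [->//|r0s] := eqVneq s r0.
have {}r0s : s < r0 by rewrite lt_neqAle r0s.
suff [r [sr rr0 Gr]] : exists r, [/\ s <= r, r < r0 & G r].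
  have : r0 <= r by apply: ge_inf; [case: hS|split;
    rewrite ?sr //= (le_trans (ltW rr0))].
  by rewrite leNgt rr0.
have [Nr0|Nr0] := pselect (N r0).
  have /nbhs_ballP[/= d1 d10 bU] : nbhs r0 U by apply: open_nbhs_nbhs;
    split => //; apply: NU.
  pose r := Num.max s (r0 - d1 / 2).
  have sr : s <= r by rewrite le_max lexx.
  have rd : r0 - d1 / 2 <= r by rewrite le_max lexx orbT.
  have rr0 : r < r0 by rewrite gt_max r0s /=; lra.
  exists r; split=> // e1 /Gr0[l [il lU le]].
  exists ((r, r0) :: l); split.
  - by rewrite intervals_cons lexx (ltW rr0) r0t.
  - move=> q; rewrite inE => /orP[/eqP ->|/lU//] z /=;
      rewrite in_itv /= => /andP[h1 h2].
    by apply: bU; rewrite /ball /= ltr_norml; apply/andP; split; lra.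
  - rewrite /V big_cons -/(V l) /=.
    have := ler_norm (f r0 - f r); nra.
have [|d1 d10 H1] := slope r0 _ Nr0 _ e0; first by rewrite r0s.
pose r := Num.max s (r0 - d1 / 2).
have sr : s <= r by rewrite le_max lexx.
have rd : r0 - d1 / 2 <= r by rewrite le_max lexx orbT.
have rr0 : r < r0 by rewrite gt_max r0s /=; lra.
exists r; split=> // e1 /Gr0[l [il lU le]].
exists l; split => //; first by apply: intervals_widen il => //; exact: ltW.
have := H1 (r0 - r); rewrite subKr => h.
have {h} := h _; have -> : 0 < r0 - r < d1 by apply/andP; split; lra.
by move=> /(_ isT); lra.
Qed.

(** One domination criterion serves for differences, absolute values, maxima and linear
    corrections. *)
Lemma abs_continuous_le2 (R : realType) (a b c : R) f g h :
  0 <= c -> abs_continuous a b f -> abs_continuous a b g ->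
  (forall u v, `|h v - h u| <= `|f v - f u| + c * `|g v - g u|) ->
  abs_continuous a b h.
Proof.
move=> c0 acf acg H e e0.
have e20 : 0 < e / 2 by lra.
have e2c0 : 0 < e / 2 / (c + 1) by apply: divr_gt0; lra.
have [d1 d10 H1] := acf _ e20; have [d2 d20 H2] := acg _ e2c0.
exists (Num.min d1 d2); first by rewrite lt_min d10.
move=> l il; rewrite lt_min => /andP[l1 l2].
have := H1 l il l1; have := H2 l il l2.
set A := \sum_(q <- l) _; set B := \sum_(q <- l) _ => hA hB.
have A0 : 0 <= A by apply: sumr_ge0.
apply: (@le_lt_trans _ _ (B + c * A)).
  rewrite /A mulr_sumr -big_split /=; exact: ler_sum.
move: hA; rewrite ltr_pdivlMr; last by lra.
nra.
Qed.

Lemma abs_continuous_id (R : realType) (a b : R) : abs_continuous a b id.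
Proof.
move=> e e0; exists e => // l /andP[/allP H _].
rewrite [X in _ -> X < _](_ : _ = \sum_(q <- l) (q.2 - q.1)) // !big_seq.
apply: eq_bigr => q /H /and3P[_ h _]; rewrite ger0_norm //; lra.
Qed.

Lemma abs_continuous_cst (R : realType) (a b c : R) :
  abs_continuous a b (fun _ => c).
Proof.
by move=> e e0; exists 1 => // l _ _; rewrite big1 // => q _;
  rewrite subrr normr0.
Qed.

Lemma left_slope_bound (R : realType) (N : set R) (s t k : R) f :
  (@lebesgue_measure R).-negligible N -> s <= t -> abs_continuous s t f ->
  (forall r, s < r <= t -> ~ N r -> left_slope_le f r k) ->
  f t - f s <= k * (t - s).
Proof.
move=> N0 st acf slope.
suff : f t - k * t <= f s - k * s by lra.
apply: (@left_slope_nonincreasing _ N _ _ (fun r => f r - k * r)) => //.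
  apply: (abs_continuous_le2 (normr_ge0 k) acf
    (@abs_continuous_id _ s t)) => u v.
  rewrite -normrM; apply: le_trans (ler_normB _ _); rewrite /=.
  by rewrite (_ : f v - k * v - _ = f v - f u - k * (v - u)) //; ring.
move=> r /slope H /H {}H e /H[d d0 {}H]; exists d => // h /H; lra.
Qed.

Lemma left_slope_derive (R : realType) (f : R -> R) (r k : R) :
  derivable f r 1 -> 'D_1 f r <= k -> left_slope_le f r k.
Proof.
move=> df Dk e e0.
have /cvgrPdist_lt /(_ _ e0) := df.
rewrite -[lim _]/('D_1 f r) => /nbhs_ballP[/= d d0 H].
exists d => // h /andP[h0 hd].
have := H (- h); rewrite /ball /= sub0r opprK gtr0_norm // oppr_eq0.
rewrite gt_eqF // => /(_ hd isT).
rewrite /= [- h *: 1]mulr1 [- h + r]addrC invrN scaleNr -scalerN opprB.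
rewrite ltr_norml => /andP[+ _].
rewrite ltrBrDl.
rewrite -[_ *: _]/(_ * _) => H2.
suff : h^-1 * (f r - f (r - h)) <= k + e by rewrite ler_pdivrMl // mulrC.
lra.
Qed.

(** * Trajectories on a ring *)

(** Being a single cycle is used only as an induction principle along the ring. Taking for [P] the
    forward orbit of a node shows that every node is reached. *)
Definition ring_map n (p : 'I_n -> 'I_n) : Prop :=
  forall P : 'I_n -> Prop, (forall i, P i -> P (p i)) -> forall i j, P i -> P j.

Lemma ring_map_rev n (p : 'I_n -> 'I_n) (P : 'I_n -> Prop) i j :
  ring_map p -> (forall k, P (p k) -> P k) -> P i -> P j.
Proof.
move=> rp H Pi; apply: contrapT => nPj.
by apply: (rp (fun k => ~ P k) _ j i nPj) => // k nPk /H.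
Qed.

(** * Limits at infinity and clipped functions *)

Lemma near_pinfty_ge0 (R : realType) (P : R -> Prop) :
  (\forall t \near +oo, P t) -> exists2 T, 0 <= T & forall t, T <= t -> P t.
Proof.
move=> [M [_ H]]; exists (Num.max 0 (M + 1)); first by rewrite le_max lexx.
by move=> t; rewrite ge_max => /andP[_ h]; apply: H; lra.
Qed.

Lemma near_pinfty_intro (R : realType) (P : R -> Prop) (T : R) :
  (forall t, T <= t -> P t) -> \forall t \near +oo, P t.
Proof. by move=> H; exists T; split; [exact: num_real|move=> t /ltW /H]. Qed.

Lemma nonincreasing_on_cvg (R : realType) (f : R -> R) (T b : R) :
  (forall s t, T <= s -> s <= t -> f t <= f s) ->
  (forall t, T <= t -> b <= f t) ->
  exists2 L : R, f t @[t --> +oo] --> L & forall t, T <= t -> L <= f t.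
Proof.
move=> mono lb; pose S := [set f t | t in [set t | T <= t]].
have hS : has_inf S.
  by split; [exists (f T); exists T => //=|exists b => _ [t /= Tt <-];
    apply: lb].
have le t : T <= t -> inf S <= f t by move=> Tt; apply: ge_inf;
  [case: hS|exists t].
exists (inf S) => //; apply/cvgrPdist_lt => e e0.
have [_ [t0 /= Tt0 <-] h] := inf_adherent e0 hS.
apply: (@near_pinfty_intro _ _ t0) => t t0t.
rewrite ler0_norm; last by rewrite subr_le0 le // (le_trans Tt0).
by have := mono _ _ Tt0 t0t; lra.
Qed.

(** The clipped function decreases to some [L >= l]. If [L > l], clipping is never active from [T]
    on and [f] itself converges; if [L = l], only the upper bound survives. *)
Lemma clip_cvg (R : realType) (f : R -> R) (T l : R) :
  (forall s t, T <= s -> s <= t -> Num.max (f t) l <= Num.max (f s) l) ->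
  (exists L : R, f t @[t --> +oo] --> L) \/
  (forall e, 0 < e -> \forall t \near +oo, f t < l + e).
Proof.
move=> mono.
have [|L cL leL] := @nonincreasing_on_cvg _ _ T l mono.
  by move=> t _; rewrite le_max lexx orbT.
have lL : l <= L.
  rewrite leNgt; apply/negP => Ll.
  have lL0 : 0 < l - L by lra.
  have [t _ /(_ t (lexx t))] := near_pinfty_ge0 ((cvgrPdist_lt _ _).1 cL _ lL0).
  rewrite ltr_norml => /andP[h _].
  have : l <= Num.max (f t) l by rewrite le_max lexx orbT.
  lra.
have [eqL|neL] := eqVneq l L.
  right=> e e0; near=> t.
  have fm : f t <= Num.max (f t) l by rewrite le_max lexx.
  apply: (le_lt_trans fm).
  have : `|L - Num.max (f t) l| < e by near: t;
    exact: (cvgrPdist_lt _ _).1 cL _ e0.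
  by rewrite ltr_norml => /andP[h _]; lra.
have {}lL : l < L by rewrite lt_neqAle neL.
left; exists L; apply/cvgrPdist_lt => e e0.
near=> t.
have Tt : T <= t by near: t; apply: nbhs_pinfty_ge; exact: num_real.
have : `|L - Num.max (f t) l| < e by near: t;
  exact: (cvgrPdist_lt _ _).1 cL _ e0.
have := leL _ Tt; rewrite le_max => /orP[Lf|Ll]; last by lra.
by rewrite max_l //; lra.
Unshelve. all: by end_near. Qed.

(** Where [f r <= l] the clipped function is at its least value, so it cannot have increased;
    elsewhere [f] is the active function at [r]. *)
Lemma left_slope_max_cst (R : realType) (f : R -> R) (r l : R) :
  (l < f r -> left_slope_le f r 0) ->
  left_slope_le (fun t => Num.max (f t) l) r 0.
Proof.
move=> H e e0; have [lf|fl] := ltP l (f r).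
  have [d d0 Hd] := H lf e e0; exists d => // h hd; have /andP[h0 _] := hd.
  have := Hd _ hd.
  have : f (r - h) <= Num.max (f (r - h)) l by rewrite le_max lexx.
  lra.
exists 1 => // h /andP[h0 _].
have : l <= Num.max (f (r - h)) l by rewrite le_max lexx orbT.
nra.
Qed.

Lemma dist_max_le (R : realType) (a b c d : R) :
  `|Num.max a b - Num.max c d| <= `|a - c| + `|b - d|.
Proof.
have h1 := ler_norm (a - c); have h2 := ler_norm (b - d).
have h3 := lerNnormlW (lexx `|a - c|); have h4 := lerNnormlW (lexx `|b - d|).
have h5 := normr_ge0 (a - c); have h6 := normr_ge0 (b - d).
by rewrite ler_norml; apply/andP; split; case: (leP a b); case: (leP c d); lra.
Qed.

Lemma abs_continuous_bigmax (R : realType) (a b : R) (I : Type) (s : seq I)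
    (f0 : R -> R) (F : I -> R -> R) :
  abs_continuous a b f0 -> (forall i, abs_continuous a b (F i)) ->
  abs_continuous a b (fun t => \big[Num.max/f0 t]_(i <- s) F i t).
Proof.
move=> ac0 acF; elim: s => [|i s IH].
  apply: (abs_continuous_le2 ler01 ac0 ac0) => u v; rewrite !big_nil.
  by rewrite lerDl mul1r.
apply: (abs_continuous_le2 ler01 (acF i) IH) => u v; rewrite !big_cons mul1r.
exact: dist_max_le.
Qed.

(* The two bounds say that the derivative of x_i lies between the one-sided
   limits of the increasing function G_i at x_(p i) - x_i. This is all that is
   used of the Filippov inclusion, and it is stable under x |-> - x. *)
Definition ring_trajectory (R : realType) n (p : 'I_n -> 'I_n)
    (G : 'I_n -> R -> R) (x : 'I_n -> R -> R) : Prop :=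
  (forall i T, abs_continuous 0 T (x i)) /\
  exists2 N : set R, (@lebesgue_measure R).-negligible N &
    forall t, 0 <= t -> ~ N t -> forall i,
      [/\ derivable (x i) t 1,
          forall z, x (p i) t - x i t < z -> 'D_1 (x i) t <= G i z &
          forall z, z < x (p i) t - x i t -> G i z <= 'D_1 (x i) t].

(** The reflection exchanges the two velocity bounds, so every one-sided result below has a mirror
    image. *)
Lemma ring_trajectory_opp (R : realType) n (p : 'I_n -> 'I_n)
    (G : 'I_n -> R -> R) (x : 'I_n -> R -> R) :
  ring_trajectory p G x ->
  ring_trajectory p (fun i z => - G i (- z)) (fun i t => - x i t).
Proof.
move=> [acx [N N0 H]]; split.
  move=> i T; apply: (abs_continuous_le2 ler01 (acx i T) (acx i T)) => u v.
  by rewrite -opprD normrN mul1r lerDl.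
exists N => // t t0 Nt i; have [dx H1 H2] := H t t0 Nt i.
have dN : derivable (- x i) t 1 by exact: derivableN.
have DN : 'D_1 (- x i) t = - 'D_1 (x i) t by exact: deriveN.
split; first exact: dN.
  move=> z hz; rewrite -[X in X <= _]/('D_1 (- x i) t) DN lerN2; apply: H2; lra.
move=> z hz; rewrite -[X in _ <= X]/('D_1 (- x i) t) DN lerN2; apply: H1; lra.
Qed.

Lemma abs_continuous_sub (R : realType) (a b a' b' : R) f :
  a' <= a -> b <= b' -> abs_continuous a' b' f -> abs_continuous a b f.
Proof.
move=> aa bb H e /H[d d0 {}H]; exists d => // l il; apply: H.
exact: intervals_widen il.
Qed.

Lemma trajectory_increment_le (R : realType) n (p : 'I_n -> 'I_n)
    (G : 'I_n -> R -> R) (x : 'I_n -> R -> R) i (s t z : R) :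
  ring_trajectory p G x -> 0 <= s -> s <= t ->
  (forall r, s < r <= t -> x (p i) r - x i r < z) ->
  x i t - x i s <= G i z * (t - s).
Proof.
move=> [acx [N N0 H]] s0 st hz.
apply: (left_slope_bound N0 st (abs_continuous_sub s0 (lexx t) (acx i t))).
move=> r hr Nr; have r0 : 0 <= r by have /andP[h _] := hr; lra.
have [dx h1 _] := H r r0 Nr i.
by apply: left_slope_derive => //; apply: h1; apply: hz.
Qed.

Lemma trajectory_increment_ge (R : realType) n (p : 'I_n -> 'I_n)
    (G : 'I_n -> R -> R) (x : 'I_n -> R -> R) i (s t z : R) :
  ring_trajectory p G x -> 0 <= s -> s <= t ->
  (forall r, s < r <= t -> z < x (p i) r - x i r) ->
  G i z * (t - s) <= x i t - x i s.
Proof.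
move=> /ring_trajectory_opp tx s0 st hz.
have H := @trajectory_increment_le _ _ _ _ _ i s t (- z) tx s0 st.
have hz' r : s < r <= t -> - x (p i) r - - x i r < - z by move=> /hz; lra.
by have := H hz'; rewrite !opprK; lra.
Qed.

Lemma trajectory_clip (R : realType) n (p : 'I_n -> 'I_n)
    (G : 'I_n -> R -> R) (x : 'I_n -> R -> R) i (T l z : R) :
  ring_trajectory p G x -> 0 <= T -> G i z <= 0 ->
  (forall r, T <= r -> l < x i r -> x (p i) r - x i r < z) ->
  forall s t, T <= s -> s <= t -> Num.max (x i t) l <= Num.max (x i s) l.
Proof.
move=> [acx [N N0 H]] T0 Gz hz s t Ts st.
have s0 := le_trans T0 Ts.
apply: (@left_slope_nonincreasing _ N s t (fun t => Num.max (x i t) l)) => //.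
  apply: (abs_continuous_sub s0 (lexx t)).
  apply: (abs_continuous_le2 ler01 (acx i t)
    (@abs_continuous_cst _ 0 t l)) => u v.
  by rewrite mul1r; exact: dist_max_le.
move=> r hr Nr; apply: left_slope_max_cst => lx.
have [sr _] := andP hr; have r0 : 0 <= r by lra.
have [dx h1 _] := H r r0 Nr i.
apply: left_slope_derive => //; apply: le_trans Gz; apply: h1; apply: hz => //.
by lra.
Qed.

(* Either some maximal node has a strictly smaller predecessor, so that its
   velocity is at most G_i 0 = 0, or all nodes agree and i0 has velocity at
   most G_i0 0+ <= 0. *)
Lemma trajectory_max_nonincreasing (R : realType) n (p : 'I_n -> 'I_n)
    (G : 'I_n -> R -> R) (x : 'I_n -> R -> R) i0 :
  ring_map p -> (forall i, G i 0 = 0) ->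
  (forall c, (forall z, 0 < z -> c <= G i0 z) -> c <= 0) ->
  ring_trajectory p G x ->
  forall s t, 0 <= s -> s <= t ->
    \big[Num.max/x i0 t]_i x i t <= \big[Num.max/x i0 s]_i x i s.
Proof.
move=> rp G0 sp [acx [N N0 H]] s t s0 st.
pose M t := \big[Num.max/x i0 t]_i x i t.
have leM i u : x i u <= M u by apply: le_bigmax.
apply: (@left_slope_nonincreasing _ N s t M) => //.
  by apply: (abs_continuous_sub s0 (lexx t)); apply: abs_continuous_bigmax.
move=> r hr Nr; have [sr _] := andP hr; have r0 : 0 <= r by lra.
suff [i [iM Di]] : exists i, x i r = M r /\ 'D_1 (x i) r <= 0.
  have [dx _ _] := H r r0 Nr i.
  move=> e e0; have [d d0 Hd] := left_slope_derive dx Di e0.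
  exists d => // h hd; have := Hd h hd; have := leM i (r - h); rewrite iM; lra.
have [all_act|] := pselect (forall i, x i r = M r).
  exists i0; split; first exact: all_act.
  apply: sp => z z0; have [_ h _] := H r r0 Nr i0.
  by apply: h; rewrite !all_act subrr.
(* If no maximal node had nonpositive velocity, maximality would pass from each node to its
   predecessor, hence to all nodes. *)
move=> nall; apply: contrapT => nex; apply: nall.
have [i1 i1M] : exists i, x i r = M r.
  have [i1 _ max1] := @Order.TotalTheory.arg_maxP _ _ _ i0 xpredT (x^~ r) isT.
  exists i1; apply/eqP; rewrite eq_le leM /=.
  by apply: bigmax_le => [|i _]; exact: max1.
move=> j; apply: (rp (fun i => x i r = M r) _ i1 j i1M) => i iM.
apply/eqP; rewrite eq_le leM leNgt; apply/negP => lt; apply: nex; exists i;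
  split=> //.
rewrite -(G0 i); have [_ h _] := H r r0 Nr i; apply: h; rewrite iM; lra.
Qed.

(** * Convergence of the coordinates along the ring *)

Lemma cvg_pinfty_le (R : realType) (f : R -> R) (L e : R) :
  f t @[t --> +oo] --> L -> 0 < e ->
  exists2 T, 0 <= T & forall t, T <= t -> L - e < f t < L + e.
Proof.
move=> cL e0; have [T T0 H] := near_pinfty_ge0 ((cvgrPdist_lt _ _).1 cL _ e0).
exists T => // t /H; rewrite ltr_norml => /andP[h1 h2]; apply/andP; split; lra.
Qed.

Lemma trajectory_clip_cvg (R : realType) n (p : 'I_n -> 'I_n)
    (G : 'I_n -> R -> R) (x : 'I_n -> R -> R) i (T l z : R) :
  ring_trajectory p G x -> 0 <= T -> G i z <= 0 ->
  (forall r, T <= r -> l < x i r -> x (p i) r - x i r < z) ->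
  (exists L : R, x i t @[t --> +oo] --> L) \/
  (forall e, 0 < e -> \forall t \near +oo, x i t < l + e).
Proof. by move=> tx T0 Gz H; apply: clip_cvg (trajectory_clip tx T0 Gz H). Qed.

(** Once the predecessor is below [L + e / 2], [x i] cannot increase above that level, so clipping
    there gives the alternative. *)
Lemma trajectory_follows_above (R : realType) n (p : 'I_n -> 'I_n)
    (G : 'I_n -> R -> R) (x : 'I_n -> R -> R) i (L : R) :
  G i 0 = 0 -> ring_trajectory p G x ->
  x (p i) t @[t --> +oo] --> L ->
  (exists L' : R, x i t @[t --> +oo] --> L') \/
  (forall e, 0 < e -> \forall t \near +oo, x i t < L + e).
Proof.
move=> G0 tx cL.
have [|nc] := pselect (exists L' : R, x i t @[t --> +oo] --> L'); first by left.
right=> e e0; have e20 : 0 < e / 2 by lra.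
have [T T0 HT] := cvg_pinfty_le cL e20.
have [||//|H] := @trajectory_clip_cvg _ _ _ _ _ i T (L + e / 2) 0 tx T0.
- by rewrite G0.
- by move=> r /HT /andP[_ h] h2; lra.
have := H _ e20; rewrite -addrA -splitr //.
Qed.

(** If neither [x i] nor its reflection is seen to converge directly, the bounds from above and
    below squeeze [x i] to [L]. *)
Lemma trajectory_follows (R : realType) n (p : 'I_n -> 'I_n)
    (G : 'I_n -> R -> R) (x : 'I_n -> R -> R) i (L : R) :
  G i 0 = 0 -> ring_trajectory p G x ->
  x (p i) t @[t --> +oo] --> L -> exists L' : R, x i t @[t --> +oo] --> L'.
Proof.
move=> G0 tx cL; have [//|above] := trajectory_follows_above G0 tx cL.
have GN0 : - G i (- 0) = 0 by rewrite oppr0 G0 oppr0.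
have [[L' cL']|below] :=
    trajectory_follows_above (i := i) GN0 (ring_trajectory_opp tx) (cvgN cL).
  exists (- L'); rewrite (_ : x i = - (fun t => - x i t)); first exact: cvgN.
  by apply/funext => t; rewrite /= opprK.
exists L; apply/cvgrPdist_lt => e e0; near=> t.
have h1 : x i t < L + e by near: t; apply: above.
have h2 : - x i t < - L + e by near: t; apply: below.
rewrite ltr_norml; apply/andP; split; lra.
Unshelve. all: by end_near. Qed.

Lemma trajectory_limit_le (R : realType) n (p : 'I_n -> 'I_n)
    (G : 'I_n -> R -> R) (x : 'I_n -> R -> R) i (L L' z : R) :
  ring_trajectory p G x ->
  x (p i) t @[t --> +oo] --> L -> x i t @[t --> +oo] --> L' ->
  z < L - L' -> G i z <= 0.
Proof.
move=> tx cL cL' zL; rewrite leNgt; apply/negP => Gz.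
have e0 : 0 < (L - L' - z) / 2 by lra.
have [T1 T10 H1] := cvg_pinfty_le cL e0.
have [T2 T20 H2] := cvg_pinfty_le cL' e0.
have [T3 T30 H3] := cvg_pinfty_le cL' ltr01.
pose T := T1 + T2 + T3.
have T1T : T1 <= T by rewrite /T; lra.
have T2T : T2 <= T by rewrite /T; lra.
have T3T : T3 <= T by rewrite /T; lra.
have T0 : 0 <= T by lra.
(* Over a time [w] the coordinate would gain 2, although from [T3] on it stays strictly within 1 of
   its limit. *)
pose w := 2 / G i z.
have w0 : 0 < w by apply: divr_gt0.
have := @trajectory_increment_ge _ _ _ _ _ i T (T + w) z tx T0.
have -> : G i z * (T + w - T) = 2 by rewrite addrC addKr /w mulrC divfK ?gt_eqF.
move=> h; have TTw : T <= T + w by lra.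
have {}h : 2 <= x i (T + w) - x i T.
  apply: h => // r /andP[Tr _];
    have /andP[h1 h2] := H1 r (ltW (le_lt_trans T1T Tr)).
  have /andP[h3 h4] := H2 r (ltW (le_lt_trans T2T Tr)); lra.
have /andP[h1 h2] := H3 _ T3T.
have T3w : T3 <= T + w by lra.
have /andP[h3 h4] := H3 _ T3w; lra.
Qed.

Lemma trajectory_limit_ge (R : realType) n (p : 'I_n -> 'I_n)
    (G : 'I_n -> R -> R) (x : 'I_n -> R -> R) i (L L' z : R) :
  ring_trajectory p G x ->
  x (p i) t @[t --> +oo] --> L -> x i t @[t --> +oo] --> L' ->
  L - L' < z -> 0 <= G i z.
Proof.
move=> tx cL cL' zL.
have zN : - z < - L - - L' by lra.
have NL : - x (p i) t @[t --> +oo] --> - L by exact: cvgN.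
have NL' : - x i t @[t --> +oo] --> - L' by exact: cvgN.
have := trajectory_limit_le (ring_trajectory_opp tx) NL NL' zN.
by rewrite opprK oppr_le0.
Qed.

(* If x_i1 does not converge, the dead zone [0, z] of G_i1 keeps it eventually
   away from the limit Ms of the maximum. A node whose predecessor stays below
   Ms - d cannot increase above that level, so being bounded away from Ms
   propagates along the ring unless some node converges. *)
Lemma trajectory_some_cvg (R : realType) n (p : 'I_n -> 'I_n)
    (G : 'I_n -> R -> R) (x : 'I_n -> R -> R) i1 (z Ms : R) :
  ring_map p -> (forall i, G i 0 = 0) -> ring_trajectory p G x ->
  0 < z -> G i1 z <= 0 ->
  (forall e, 0 < e -> \forall t \near +oo, forall i, x i t < Ms + e) ->
  (forall t, 0 <= t -> exists i, Ms <= x i t) ->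
  exists i (L : R), x i t @[t --> +oo] --> L.
Proof.
move=> rp G0 tx z0 Gz up low; apply: contrapT => nc.
have nci i : ~ (exists L : R, x i t @[t --> +oo] --> L).
  by move=> [L cL]; apply: nc; exists i, L.
pose P i := exists2 d, 0 < d & \forall t \near +oo, x i t < Ms - d.
have P1 : P i1.
  (* Eventually the predecessor is below [Ms + z / 2], so above the level [Ms - z / 2] the gap is
     less than [z]. A tolerance of [z / 4] over that level leaves the margin [z / 4]. *)
  exists (z / 4); first lra.
  have z20 : 0 < z / 2 by lra.
  have z40 : 0 < z / 4 by lra.
  have [T T0 HT] := near_pinfty_ge0 (up _ z20).
  have [|/nci//|H] :=
    @trajectory_clip_cvg _ _ _ _ _ i1 T (Ms - z / 2) z tx T0 Gz.
    by move=> r /HT /(_ (p i1)); lra.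
  by have := H _ z40; rewrite (_ : Ms - z / 2 + z / 4 = Ms - z / 4) //; lra.
have Pstep i : P (p i) -> P i.
  move=> [d d0 /near_pinfty_ge0[T T0 HT]]; exists (d / 2); first lra.
  have d20 : 0 < d / 2 by lra.
  have [||/nci//|H] := @trajectory_clip_cvg _ _ _ _ _ i T (Ms - d) 0 tx T0.
  - by rewrite G0.
  - by move=> r /HT h1 h2; lra.
  by have := H _ d20; rewrite (_ : Ms - d + d / 2 = Ms - d / 2) //; lra.
have Pall j : P j := @ring_map_rev _ p P i1 j rp Pstep P1.
have /near_pinfty_ge0[T T0 HT] : \forall t \near +oo, forall i, x i t < Ms.
  apply: filter_forall => i; have [d d0 H] := Pall i.
  by near=> t; apply: (@lt_trans _ _ (Ms - d)); [near: t|lra].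
by have [i] := low T T0; rewrite leNgt HT.
Unshelve. all: by end_near. Qed.

(* If x_i is near Ms at time t while x_(p i) is not, then x_i has been
   decreasing at a definite rate on some [t - tau, t], hence was above Ms + e
   before. So closeness to Ms passes from a node to its predecessor. *)
Lemma trajectory_consensus (R : realType) n (p : 'I_n -> 'I_n)
    (G : 'I_n -> R -> R) (x : 'I_n -> R -> R) (Ms K : R) :
  ring_map p -> (forall i z, z < 0 -> G i z < 0) -> ring_trajectory p G x ->
  0 < K ->
  (forall i s t, 0 <= s -> s <= t -> `|x i t - x i s| <= K * (t - s)) ->
  (forall e, 0 < e -> \forall t \near +oo, forall i, x i t < Ms + e) ->
  (forall t, 0 <= t -> exists i, Ms <= x i t) ->
  forall i, x i t @[t --> +oo] --> Ms.
Proof.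
move=> rp Gneg tx K0 lip up low.
pose P i j := forall e', 0 < e' -> exists2 e, 0 < e &
  \forall t \near +oo, Ms - e <= x i t -> Ms - e' <= x j t.
have Pstep i : P i (p i).
  (* During [tau] each coordinate moves by at most [e' / 3]. With [e <= e' / 7] the gap stays below
     [- 6 e' / 7 + 2 e' / 3 < - e' / 6], so [x i] falls at rate at least [eta]. With
     [3 e <= eta * tau] it was at least [Ms + 2 e] at time [s], which [up] forbids. *)
  move=> e' e'0; pose tau := e' / (3 * K).
  have tau0 : 0 < tau by apply: divr_gt0; lra.
  have Ktau : K * tau = e' / 3 by rewrite /tau; field; lra.
  pose eta := - G i (- (e' / 6)).
  have eta0 : 0 < eta by rewrite oppr_gt0; apply: Gneg; lra.
  pose e := Num.min (e' / 7) (eta * tau / 3).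
  have e0 : 0 < e.
    by rewrite lt_min; apply/andP; split; [lra|have := mulr_gt0 eta0 tau0; lra].
  have e1 : e <= e' / 7 by rewrite ge_min lexx.
  have e2 : e <= eta * tau / 3 by rewrite ge_min lexx orbT.
  exists e => //; have [T T0 HT] := near_pinfty_ge0 (up _ e0).
  apply: (@near_pinfty_intro _ _ (T + tau)) => t Tt hi; rewrite leNgt;
    apply/negP => hp.
  pose s := t - tau.
  have Ts : T <= s by rewrite /s; lra.
  have s0 : 0 <= s by lra.
  have st : s <= t by rewrite /s; lra.
  have near_t j r : s < r <= t -> `|x j t - x j r| <= e' / 3.
    move=> /andP[sr rt]; have r0 : 0 <= r by lra.
    apply: le_trans (lip j r t r0 rt) _; rewrite -Ktau ler_pM2l //;
      rewrite /s in sr; lra.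
  have := @trajectory_increment_le _ _ _ _ _ i s t (- (e' / 6)) tx s0 st.
  have -> : t - s = tau by rewrite /s subKr.
  have yneg r : s < r <= t -> x (p i) r - x i r < - (e' / 6).
    move=> hr; have := near_t i r hr; have := near_t (p i) r hr.
    by rewrite !ler_norml => /andP[h1 h2] /andP[h3 h4]; lra.
  move=> /(_ yneg); have := HT s Ts i; rewrite /eta in e2; lra.
have Pall i j : P i j.
  apply: (rp (P i) _ i j) => [k Pk e' /(Pstep k)[e1 e10 H1]|e' e'0]; last first.
    by exists e' => //; apply: (@near_pinfty_intro _ _ 0).
  have [e e0 H] := Pk _ e10; exists e => //.
  by apply: filterS2 H1 H => t h1 h2 /h2 /h1.
move=> j; apply/cvgrPdist_lt => e e0; have e20 : 0 < e / 2 by lra.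
have H : \forall t \near +oo, forall i, Ms <= x i t -> Ms - e / 2 <= x j t.
  apply: filter_forall => i; have [e1 e10 H1] := Pall i j _ e20.
  by apply: filterS H1 => t h1 h; apply: h1; lra.
near=> t.
have t0 : 0 <= t by near: t; apply: nbhs_pinfty_ge; exact: num_real.
have [i hi] := low t t0.
have h1 : Ms - e / 2 <= x j t.
  have h : forall i, Ms <= x i t -> Ms - e / 2 <= x j t by near: t.
  exact: h hi.
have h2 : x j t < Ms + e.
  have h : forall i, x i t < Ms + e by near: t; exact: up.
  exact: h.
rewrite ltr_norml; apply/andP; split; lra.
Unshelve. all: by end_near. Qed.

(** For increasing [G], the hypotheses on [i0] constrain its one-sided limits at 0, and the
    conclusion places 0 between the one-sided limits of each [G i] at the limiting gap, the form in
    which membership in [H2] is checked. *)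
Lemma ring_trajectory_cvg (R : realType) n (p : 'I_n -> 'I_n)
    (G : 'I_n -> R -> R) (x : 'I_n -> R -> R) i0 :
  ring_map p -> (forall i, G i 0 = 0) ->
  (forall c, (forall z, 0 < z -> c <= G i0 z) -> c <= 0) ->
  (forall c, (forall z, z < 0 -> G i0 z <= c) -> 0 <= c) ->
  ring_trajectory p G x ->
  exists w : 'I_n -> R, forall i,
    [/\ x i t @[t --> +oo] --> w i,
        forall z, z < w (p i) - w i -> G i z <= 0 &
        forall z, w (p i) - w i < z -> 0 <= G i z].
Proof.
move=> rp G0 sp sn tx.
pose GN i z := - G i (- z); pose xN i t : R := - x i t.
have txN : ring_trajectory p GN xN := ring_trajectory_opp tx.
have GN0 i : GN i 0 = 0 by rewrite /GN oppr0 G0 oppr0.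
have spN c : (forall z, 0 < z -> c <= GN i0 z) -> c <= 0.
  move=> H; rewrite -oppr_ge0; apply: sn => z z0.
  have := H (- z); rewrite /GN opprK oppr_gt0 => /(_ z0); lra.
have monoM := trajectory_max_nonincreasing rp G0 sp tx.
have monoN := trajectory_max_nonincreasing rp GN0 spN txN.
pose M t := \big[Num.max/x i0 t]_i x i t.
pose MN t := \big[Num.max/xN i0 t]_i xN i t.
have leM i t : x i t <= M t by apply: le_bigmax.
have leMN i t : xN i t <= MN t by apply: le_bigmax.
have attained (u : 'I_n -> R) : exists i, \big[Num.max/u i0]_i u i = u i.
  have [i1 _ max1] := @Order.TotalTheory.arg_maxP _ _ _ i0 xpredT u isT.
  exists i1; apply/eqP; rewrite eq_le le_bigmax andbT.
  by apply: bigmax_le => [|i _]; exact: max1.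
have ub i t : 0 <= t -> x i t <= M 0.
  by move=> t0; apply: le_trans (leM i t) _; apply: monoM.
have lb i t : 0 <= t -> - MN 0 <= x i t.
  move=> t0; rewrite lerNl; apply: le_trans (leMN i t) _; exact: monoN.
(* Stated for an arbitrary family, to be applied to [x] in one case and to its reflection in the
   other. *)
have limit (y : 'I_n -> R -> R) (b : R) :
    (forall s t, 0 <= s -> s <= t ->
      \big[Num.max/y i0 t]_i y i t <= \big[Num.max/y i0 s]_i y i s) ->
    (forall i t, 0 <= t -> b <= y i t) -> exists Ms,
    (forall e, 0 < e -> \forall t \near +oo, forall i, y i t < Ms + e) /\
    (forall t, 0 <= t -> exists i, Ms <= y i t).
  move=> mono low.
  have [|Ms cM leMs] := nonincreasing_on_cvg (b := b) mono.
    by move=> t t0; apply: le_trans (low i0 t t0) _; apply: le_bigmax.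
  exists Ms; split=> [e e0|t t0]; last first.
    by have [i iE] := attained (y^~ t); exists i; rewrite -iE; exact: leMs.
  have [T T0 HT] := cvg_pinfty_le cM e0.
  apply: (@near_pinfty_intro _ _ T) => t /HT /andP[_ h] i.
  by apply: le_lt_trans h; apply: le_bigmax.
suff [w cw] : exists w : 'I_n -> R, forall i, x i t @[t --> +oo] --> w i.
  exists w => i; split; first exact: cw.
    by move=> z hz; exact: trajectory_limit_le tx (cw _) (cw _) hz.
  by move=> z hz; exact: trajectory_limit_ge tx (cw _) (cw _) hz.
have [[i1 [z [z0 Gz]]]|nG] := pselect (exists i z, 0 < z /\ G i z <= 0).
  have [Ms [up low]] := limit x (- MN 0) monoM lb.
  have some := trajectory_some_cvg rp G0 tx z0 Gz up low.
  have all_cvg j : exists L : R, x j t @[t --> +oo] --> L.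
    have [i iP] := some.
    apply: (@ring_map_rev _ p
      (fun i => exists L : R, x i t @[t --> +oo] --> L) i j) => //.
    by move=> k [L cL]; exact: trajectory_follows (G0 k) tx cL.
  by have [w cw] := choice all_cvg; exists w.
have GNneg i z : z < 0 -> GN i z < 0.
  move=> z0; rewrite /GN oppr_lt0 ltNge; apply/negP => h; apply: nG.
  by exists i, (- z); split; [lra|].
have lbN i t : 0 <= t -> - M 0 <= xN i t by move=> t0; rewrite lerN2; exact: ub.
have [Ms [up low]] := limit xN (- M 0) monoN lbN.
(* All coordinates stay in [[- MN 0, M 0]], so every gap lies strictly between [- D] and [D], and
   the values of [G] at these two points bound the speeds. *)
pose D := M 0 + MN 0 + 1.
pose K := 1 + \sum_i (`|G i D| + `|G i (- D)|).
have K0 : 0 < K by rewrite ltr_pwDl // sumr_ge0 // => i _; rewrite addr_ge0.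
have GK i : `|G i D| <= K /\ `|G i (- D)| <= K.
  rewrite /K (bigD1 i) //=.
  have : 0 <= \sum_(j < n | j != i) (`|G j D| + `|G j (- D)|).
    by rewrite sumr_ge0 // => j _; rewrite addr_ge0.
  by have := normr_ge0 (G i D); have := normr_ge0 (G i (- D)); split; lra.
have lip i s t : 0 <= s -> s <= t -> `|xN i t - xN i s| <= K * (t - s).
  move=> s0 st; rewrite /xN -opprD normrN ler_norml.
  have inc := @trajectory_increment_le _ _ _ _ _ i s t D tx s0 st.
  have dec := @trajectory_increment_ge _ _ _ _ _ i s t (- D) tx s0 st.
  have bnd r : s < r <= t -> - D < x (p i) r - x i r < D.
    move=> /andP[sr _]; have r0 : 0 <= r by lra.
    have := ub i r r0; have := ub (p i) r r0; have := lb i r r0;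
      have := lb (p i) r r0.
    by rewrite /D => h1 h2 h3 h4; apply/andP; split; lra.
  have {}inc := inc (fun r hr => (andP (bnd r hr)).2).
  have {}dec := dec (fun r hr => (andP (bnd r hr)).1).
  have [] := GK i; rewrite !ler_norml => /andP[h1 h2] /andP[h3 h4].
  by apply/andP; split; nra.
have cN := trajectory_consensus rp GNneg txN K0 lip up low.
exists (fun _ => - Ms) => i.
rewrite (_ : x i = - xN i); first exact: cvgN.
by apply/funext => t; rewrite /xN /= opprK.
Qed.

(** * Filippov solutions of the ring system *)

(** Edge [k] points at node [k], so of two consecutive edges the first is the predecessor of the
    second. Opening the cycle at [i] and reading it backwards from the closing [i] spreads [P] to
    every node. *)
Lemma directed_ring_map n (G : digraph n n) :
  directed_ring G -> (forall i, edge_head G i = i) -> ring_map (edge_tail G).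
Proof.
move=> [s [cs /perm_mem sE _]] headE P clP i j Pi.
have mem k : k \in s by rewrite sE mem_enum.
have [k s' Es] := rot_to (mem i).
have : j \in i :: s' by rewrite -Es mem_rot.
move: cs; rewrite -(rot_cycle k) Es /=; set e := (fun _ _ => _).
have chain l y : path e y (rcons l i) -> forall z, z \in y :: l -> P z.
  elim: l y => [|h l IH] y /=.
    rewrite /e andbT headE => /eqP yE z; rewrite inE => /eqP ->.
    by rewrite yE; exact: clP.
  rewrite {1}/e headE => /andP[/eqP yE /IH H] z;
    rewrite inE => /orP[/eqP ->|/H//].
  by rewrite yE; apply: clP; apply: H; rewrite inE eqxx.
by move=> /chain; apply.
Qed.

(** A fixed point would be the whole ring. Hence edges are not loops, and a column of the incidence
    matrix has both entries 1 and -1. *)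
Lemma ring_map_neq n (p : 'I_n -> 'I_n) i :
  (2 <= n)%N -> ring_map p -> p i != i.
Proof.
move=> n2 rp; apply/negP => /eqP pi.
have all_i (j : 'I_n) : j = i by apply: (rp (fun k => k = i) _ i) => // k ->.
case: n n2 p i rp pi all_i => [|[|n]] // _ p i _ _ all_i.
have := congr1 val (all_i ord0); have := congr1 val (all_i (inord 1)).
by rewrite /= inordK // => <-.
Qed.

Lemma edge_diffE (R : realType) n m (G : digraph n m) k (x : 'cV[R]_n) :
  edge_tail G k != edge_head G k ->
  edge_diff G k x = x (edge_tail G k) 0 - x (edge_head G k) 0.
Proof.
move=> neq; rewrite /edge_diff mxE (bigD1 (edge_tail G k)) //=.
rewrite (bigD1 (edge_head G k)) 1?eq_sym //=.
rewrite !mxE !eqxx (negbTE neq) mul1r mulN1r.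
rewrite big1 ?addr0 // => j /andP[j1 j2].
by rewrite !mxE eq_sym (negbTE j1) eq_sym (negbTE j2) mul0r.
Qed.

(** * Norms, null sets and Filippov hulls *)

Lemma coord_le_enorm (R : realType) p (v : 'cV[R]_p) i : `|v i 0| <= enorm v.
Proof.
rewrite /enorm -sqrtr_sqr ler_wsqrtr // (bigD1 i) //= lerDl.
by apply: sumr_ge0 => j _; exact: sqr_ge0.
Qed.

Lemma enorm_le_sum (R : realType) p (v : 'cV[R]_p) : enorm v <= \sum_i `|v i 0|.
Proof.
rewrite /enorm -[leRHS]ger0_norm ?sumr_ge0 // -sqrtr_sqr ler_wsqrtr //.
have : 0 <= \sum_i `|v i 0| /\ \sum_i v i 0 ^+ 2 <= (\sum_i `|v i 0|) ^+ 2.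
  elim/big_rec2 : _ => [|i a b _ [b0 H]]; first by rewrite expr0n.
  split; first exact: addr_ge0.
  have := real_normK (num_real (v i 0)); have := normr_ge0 (v i 0).
  by move: H; rewrite !expr2; nra.
by case.
Qed.

(** The dimension must be positive: for dimension 0 the empty product gives every box volume 1, and
    the sums are infinite. *)
Lemma lebesgue_outer_set0 (R : realType) p :
  lebesgue_outer (set0 : set 'cV[R]_p.+1) = 0%E.
Proof.
apply/eqP; rewrite eq_le; apply/andP; split.
  apply: ereal_inf_lbound; exists (fun=> 0), (fun=> 0); split=> //.
  rewrite eseries0 // => k _ _; rewrite big_ord_recl mxE subrr mul0r //.
apply: le_ereal_inf_tmp => _ [l [u [lu _ ->]]]; apply: nneseries_ge0 => k _ _.
by rewrite lee_fin; apply: prodr_ge0 => i _; rewrite subr_ge0.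
Qed.

Lemma convE (R : realType) p (v w : 'cV[R]_p) (t : {i01 R}) (i : 'I_p) :
  (conv t (v : convex_lmodType 'cV[R]_p) w : 'cV[R]_p) i 0 =
  t%:num * v i 0 + (1 - t%:num) * w i 0.
Proof. by rewrite [LHS]mxE !mxE. Qed.

(** The vectors with [i]-th coordinate in [C] form a closed convex set, which therefore contains the
    hull for radius [d] and empty exceptional set. *)
Lemma filippov_subset (R : realType) p (X : 'cV[R]_p -> 'cV[R]_p) x v i
    (d : R) (C : set R) :
  closed C -> is_interval C -> 0 < d ->
  (forall y, eball x d y -> C (X y i 0)) -> filippov X x v -> C (v i 0).
Proof.
case: p X x v i => [|p] X x v i; first by case: i.
move=> clC itvC d0 H /(_ d d0 set0 (lebesgue_outer_set0 _ _)).
apply: (_ : smallest _ _ `<=` [set w : 'cV[R]_p.+1 | C (w i 0)]).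
apply: smallest_sub; last by move=> _ [y [yd _] <-]; exact: H.
split.
  apply: (closed_comp _ clC) => w _; exact: coord_continuous.
move=> w1 w2 t; rewrite !inE /= => C1 C2; rewrite convE.
have t0 : 0 <= t%:num by []. have t1 : t%:num <= 1 by [].
have [h|h] := leP (w1 i 0) (w2 i 0).
  by apply: (itvC _ _ C1 C2); apply/andP; split; nra.
by apply: (itvC _ _ C2 C1); apply/andP; split; nra.
Qed.

(** Otherwise boxes of total length less than [b - a] would cover the whole interval. *)
Lemma null_set_itv (R : realType) (S : set 'cV[R]_1) (a b : R) :
  lebesgue_outer S = 0%E -> a < b -> exists2 z, a < z < b & ~ S z%:M.
Proof.
move=> S0 ab; apply: contrapT => nex.
have sub z : a < z < b -> S z%:M.
  by move=> hz; apply: contrapT => nS; apply: nex; exists z.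
have : (lebesgue_outer S < (b - a)%:E)%E by rewrite S0 lte_fin subr_gt0.
move=> /ereal_inf_lt[_ [l [u [lu Slu ->]]]]; apply/negP; rewrite -leNgt.
pose F k := `[l k 0 0, u k 0 0]%classic : set R.
have -> : (b - a)%:E = lebesgue_measure (`]a, b[%classic : set R).
  by rewrite lebesgue_measure_itv /= lte_fin ab EFinB.
have : (lebesgue_measure (`]a, b[%classic : set R) <=
    \sum_(0 <= k <oo) lebesgue_measure (F k))%E.
  apply: measure_sigma_subadditive; [by move=> k; exact: measurable_itv|by []|].
  move=> z /=; rewrite in_itv /= => /sub /Slu[k _ /(_ 0)].
  by rewrite mxE /= mulr1n => h; exists k => //=; rewrite in_itv.
move=> /le_trans; apply; apply: lee_nneseries => // k _.
rewrite lebesgue_measure_itv /= lte_fin big_ord_recl big_ord0 mulr1.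
by case: ifPn => // _; rewrite lee_fin subr_ge0.
Qed.

(** Every null set misses points of the ball on both sides of [y]; the values of [g] there enclose
    [c], which is thus a convex combination of them. *)
Lemma filippov1_mem (R : realType) (g : R -> R) (y c : R) :
  (forall z, z < y -> g z <= c) -> (forall z, y < z -> c <= g z) ->
  filippov1 g y c.
Proof.
move=> lo hi d d0 S S0 C [[_ convC] imC].
have memC z : `|z - y| < d -> ~ S z%:M -> C (g z)%:M.
  move=> zd nS; apply: imC; exists z%:M; last by rewrite mxE mulr1n.
  split=> //; rewrite /eball /= /enorm big_ord_recl big_ord0 addr0 !mxE !mulr1n.
  by rewrite sqrtr_sqr.
have dy : y - d < y by rewrite ltrBlDr ltrDl.
have yd : y < y + d by rewrite ltrDl.
have [z1 /andP[h1 h2] /(memC z1) C1] := null_set_itv S0 dy.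
have [z2 /andP[h3 h4] /(memC z2) C2] := null_set_itv S0 yd.
have {}C1 : C (g z1)%:M by apply: C1; rewrite ltr_norml; apply/andP; split; lra.
have {}C2 : C (g z2)%:M by apply: C2; rewrite ltr_norml; apply/andP; split; lra.
have g1 := lo _ h2; have g2 := hi _ h3.
have [g12|g12] := eqVneq (g z1) (g z2).
  by rewrite (_ : c = g z1) //; apply/eqP; rewrite eq_le g1 g12 g2.
have lt12 : g z1 < g z2 by rewrite lt_neqAle g12 (le_trans g1).
pose t := (g z2 - c) / (g z2 - g z1).
have t0 : 0 <= t by apply: divr_ge0; lra.
have t1 : t <= 1 by rewrite ler_pdivrMr; lra.
have := convC _ _ (Itv01 t0 t1) (mem_set C1) (mem_set C2); rewrite inE.
congr (C _); apply/matrixP => i j; rewrite !ord1 convE !mxE !mulr1n /=.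
by rewrite /t; field; lra.
Qed.

Lemma abs_continuous_coord (R : realType) p (T : R) (x : R -> 'cV[R]_p) i :
  abs_continuous_on 0 T x -> abs_continuous 0 T (fun t => x t i 0).
Proof.
move=> ac e /ac[d d0 H]; exists d => // l /andP[/allP bnd pw].
rewrite !(big_nth (0, 0)) !big_mkord => sumd.
pose u (k : 'I_(size l)) := (nth (0, 0) l k).1.
pose v (k : 'I_(size l)) := (nth (0, 0) l k).2.
apply: le_lt_trans (H _ u v _ _ sumd).
- apply: ler_sum => k _; apply: le_trans (coord_le_enorm _ i).
  by rewrite !mxE.
- by move=> k; have /and3P := bnd _ (mem_nth (0, 0) (ltn_ord k)).
move=> k k' _ _ [z [/= ]]; rewrite !in_itv /= => /andP[h1 h2] /andP[h3 h4].
have hP := pairwiseP (0, 0) pw.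
apply: val_inj; case: (ltngtP k k') => // kk.
  have := hP k k'; rewrite !inE /= => /(_ (ltn_ord _) (ltn_ord _) kk).
  by move=> /(lt_le_trans h2) /(lt_trans h3); rewrite ltxx.
have := hP k' k; rewrite !inE /= => /(_ (ltn_ord _) (ltn_ord _) kk).
by move=> /(lt_le_trans h4) /(lt_trans h1); rewrite ltxx.
Qed.

Lemma filippov_ring_trajectory (R : realType) n (G : digraph n n)
    (a : 'I_n -> R) (g : 'I_n -> R -> R) (x : R -> 'cV[R]_n) :
  (2 <= n)%N -> ring_map (edge_tail G) -> (forall i, edge_head G i = i) ->
  (forall i, 0 < a i) -> (forall i, {homo g i : y z / y <= z}) ->
  filippov_solution (ring_system G a g) x ->
  ring_trajectory (edge_tail G) (fun i z => a i * g i z) (fun i t => x t i 0).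
Proof.
move=> n2 rp headE a0 gh [acx ae].
have edE i (y : 'cV[R]_n) : edge_diff G i y = y (edge_tail G i) 0 - y i 0.
  by rewrite edge_diffE headE // ring_map_neq.
split.
  (* A solution is controlled only for [T >= 0], so negative [T] is covered by a larger interval. *)
  move=> i T; apply: (@abs_continuous_sub _ 0 T 0 (Num.max 0 T)) => //.
    by rewrite le_max lexx orbT.
  by apply: abs_continuous_coord; apply: acx; rewrite le_max lexx.
eexists; first exact: ae.
move=> t t0 nNt i; have [dx fx] := contrapT nNt t0.
have Di : 'D_1 (fun t => x t i 0) t = (derive1 x t) i 0.
  by rewrite derive1E derive_mx // mxE.
have close d y : eball (x t) d y ->
    `|edge_diff G i y - edge_diff G i (x t)| < d + d.
  move=> yd; rewrite !edE.
  have h1 := le_lt_trans (coord_le_enorm (y - x t) i) yd.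
  have h2 := le_lt_trans (coord_le_enorm (y - x t) (edge_tail G i)) yd.
  move: h1 h2; rewrite !mxE !ltr_norml => /andP[h1 h2] /andP[h3 h4].
  by apply/andP; split; lra.
split; first by have /derivable_mxP := dx; exact.
  move=> z; rewrite -edE Di => hz.
  (* Within distance [d] of [x t] the gap changes by less than [2 d], so it stays below [z]. *)
  have d0 : 0 < (z - edge_diff G i (x t)) / 2 by lra.
  apply: (@filippov_subset _ _ _ _ _ i _
    [set c | c <= a i * g i z] _ _ d0 _ fx).
  - exact: closed_le.
  - by move=> u v /= _ hv w /andP[_ wv]; apply: le_trans hv.
  move=> y /close; rewrite ltr_norml => /andP[_ h] /=.
  by rewrite mxE ler_pM2l //; apply: gh; lra.
move=> z; rewrite -edE Di => hz.
have d0 : 0 < (edge_diff G i (x t) - z) / 2 by lra.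
apply: (@filippov_subset _ _ _ _ _ i _ [set c | a i * g i z <= c] _ _ d0 _ fx).
- exact: closed_ge.
- by move=> u v /= hu _ w /andP[uw _]; apply: le_trans uw.
move=> y /close; rewrite ltr_norml => /andP[h _] /=.
by rewrite mxE ler_pM2l //; apply: gh; lra.
Qed.

(** The comparison point may move with time: for two nodes only the distance between the coordinates
    is shown to converge. *)
Lemma converges_to_set_dist (R : realType) p (x z : R -> 'cV[R]_p) A :
  (forall t, A (z t)) ->
  (forall i, (x t i 0 - z t i 0) @[t --> +oo] --> (0 : R)) ->
  converges_to_set x A.
Proof.
move=> Az cz.
pose b t := \sum_i `|x t i 0 - z t i 0|.
have cb : b t @[t --> +oo] --> (0 : R).
  rewrite [X in _ --> X](_ : 0 = \sum_(i < p) `|0 : R|); last first.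
    by rewrite big1 // => i _; rewrite normr0.
  apply: cvg_big => [|i _]; first exact: add_continuous.
  by apply: cvg_norm; exact: cz.
apply: (@squeeze_cvge _ _ _ _ (fun=> 0%E) _ (fun t => (b t)%:E)).
- near=> t; apply/andP; split.
    by apply: le_ereal_inf_tmp => _ [y _ <-]; rewrite lee_fin sqrtr_ge0.
  apply: (@le_trans _ _ (enorm (x t - z t))%:E).
    by apply: ereal_inf_lbound; exists (z t).
  rewrite lee_fin; apply: le_trans (enorm_le_sum _) _.
  by apply: ler_sum => i _; rewrite !mxE.
- exact: cvg_cst.
- by apply: cvg_EFin => //; near=> t.
Unshelve. all: by end_near. Qed.

(** * Two nodes *)

(** With the gap above [z], node [i] rises at rate at least [G i z], and by oddness node [j] falls
    at rate at least [G j z]. *)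
Lemma two_node_left_slope (R : realType) n (p : 'I_n -> 'I_n)
    (G : 'I_n -> R -> R) (x : 'I_n -> R -> R) i j (r z : R) :
  p i = j -> p j = i -> (forall k y, G k y = - G k (- y)) ->
  (forall k, derivable (x k) r 1) ->
  (forall k y, x (p k) r - x k r < y -> 'D_1 (x k) r <= G k y) ->
  (forall k y, y < x (p k) r - x k r -> G k y <= 'D_1 (x k) r) ->
  z < x j r - x i r -> 0 <= z ->
  left_slope_le (fun t => `|x j t - x i t|) r (- (G i z + G j z)).
Proof.
move=> pi pj oddG dx up lo hz z0 e e0.
have Dle : 'D_1 (x j - x i) r <= - (G i z + G j z).
  rewrite deriveB //.
  have h1 : G i z <= 'D_1 (x i) r by apply: lo; rewrite pi.
  have h2 : 'D_1 (x j) r <= G j (- z) by apply: up; rewrite pj; lra.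
  by have := oddG j z; lra.
have dxB : derivable (x j - x i) r 1 by exact: derivableB.
have [d d0 H] := left_slope_derive dxB Dle e0.
exists d => // h /H; rewrite [`|x j r - _|]ger0_norm; last by lra.
have := ler_norm (x j (r - h) - x i (r - h)).
rewrite -[(x j - x i) r]/(x j r - x i r).
by rewrite -[(x j - x i) (r - h)]/(x j (r - h) - x i (r - h)); lra.
Qed.

Lemma two_node_cvg (R : realType) n (p : 'I_n -> 'I_n)
    (G : 'I_n -> R -> R) (x : 'I_n -> R -> R) i j :
  p i = j -> p j = i -> (forall k y, G k y = - G k (- y)) ->
  (forall k, {homo G k : y z / y <= z}) ->
  ring_trajectory p G x ->
  exists D : R, [/\ `|x j t - x i t| @[t --> +oo] --> D,
    forall t, 0 <= t -> D <= `|x j t - x i t|, 0 <= D &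
    forall z, z < D -> G i z <= 0 /\ G j z <= 0].
Proof.
move=> pi pj oddG Gh [acx [N N0 H]].
pose D t := `|x j t - x i t|.
have G0 k : G k 0 = 0 by have := oddG k 0; rewrite oppr0; lra.
have acD t : abs_continuous 0 t D.
  apply: (abs_continuous_le2 ler01 (acx j t) (acx i t)) => u v.
  rewrite mul1r; apply: le_trans (ler_dist_dist _ _) _.
  rewrite (_ : _ - _ = x j v - x j u - (x i v - x i u)); last by ring.
  exact: ler_normB.
have slope (r z : R) : 0 <= r -> ~ N r -> 0 <= z -> z < D r ->
    left_slope_le D r (- (G i z + G j z)).
  move=> r0 Nr z0; have Hr := H r r0 Nr.
  have dx k : derivable (x k) r 1 by have [] := Hr k.
  have up k y : x (p k) r - x k r < y -> 'D_1 (x k) r <= G k y.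
    by have [_ h _] := Hr k; exact: h.
  have lo k y : y < x (p k) r - x k r -> G k y <= 'D_1 (x k) r.
    by have [_ _ h] := Hr k; exact: h.
  rewrite ltr_normr => /orP[hz|hz];
    first exact: (@two_node_left_slope _ _ p G x i j r z).
  rewrite (_ : D = fun t => `|x i t - x j t|); last first.
    by apply/funext => t; rewrite /D distrC.
  rewrite addrC; apply: (@two_node_left_slope _ _ p G x j i r z) => //; lra.
have monoD s t : 0 <= s -> s <= t -> D t <= D s.
  move=> s0 st; apply: (@left_slope_nonincreasing _ N s t D) => //.
    exact: abs_continuous_sub s0 (lexx t) (acD t).
  move=> r /andP[sr _] Nr; have r0 : 0 <= r by lra.
  have [Dr|Dr] := ltP 0 (D r).
    by have := slope r 0 r0 Nr (lexx 0) Dr; rewrite !G0 addr0 oppr0.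
  (* Where the distance vanishes it is minimal, so it cannot have increased. *)
  move=> e e0; exists 1 => // h /andP[h0 _].
  have := normr_ge0 (x j (r - h) - x i (r - h)); rewrite -/(D (r - h)); nra.
have [|L cL leL] := nonincreasing_on_cvg (b := 0) monoD.
  by move=> t _; exact: normr_ge0.
have L0 : 0 <= L.
  rewrite leNgt; apply/negP => Lneg; have NL0 : 0 < - L by lra.
  have [T T0 /(_ T (lexx T))] := cvg_pinfty_le cL NL0.
  by rewrite subrr => /andP[_]; rewrite ltNge normr_ge0.
exists L; split=> // z zL.
have [zneg|zpos] := leP z 0.
  by split; [rewrite -(G0 i)|rewrite -(G0 j)]; apply: Gh.
have Gi : 0 <= G i z by rewrite -(G0 i); apply: Gh; exact: ltW.
have Gj : 0 <= G j z by rewrite -(G0 j); apply: Gh; exact: ltW.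
suff : G i z + G j z <= 0 by split; lra.
rewrite leNgt; apply/negP => k0.
(* By this time the distance would have lost [D 0 + 1], more than it had. *)
pose t := (D 0 + 1) / (G i z + G j z).
have D00 : 0 <= D 0 by exact: normr_ge0.
have t0 : 0 <= t by apply: divr_ge0; lra.
have := left_slope_bound N0 t0 (acD t) (k := - (G i z + G j z)).
have tE : (G i z + G j z) * t = D 0 + 1 by rewrite /t mulrC divfK ?gt_eqF.
rewrite subr0 mulNr tE => /(_ _)-h.
have {}h : D t - D 0 <= - (D 0 + 1).
  apply: h => r /andP[r0 _] Nr; apply: slope => //; [exact: ltW..|].
  by apply: lt_le_trans zL _; apply: leL; exact: ltW.
by have : 0 <= D t := normr_ge0 _; lra.
Qed.

Unset Implicit Arguments.

Theorem mainTheorem4 (R : realType) (n : nat) (hn : (2 <= n)%N)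
    (G : digraph n n) (ringG : directed_ring G)
    (labelG : forall i : 'I_n, edge_head G i = i)
    (a : 'I_n -> R) (a_gt0 : forall i, 0 < a i)
    (g : 'I_n -> R -> R)
    (g_incr : forall i, {homo g i : y z / y <= z})
    (g_lim : forall i, `|g i y| @[y --> +oo] --> +oo)
    (hcases :
       (n = 2%N /\ forall (i : 'I_n) (y : R), g i y = - g i (- y)) \/
       [/\ (3 <= n)%N, forall i : 'I_n, g i 0 = 0 &
           exists i : 'I_n, filippov1 (g i) 0 = [set 0]]) :
  forall x : R -> 'cV[R]_n, filippov_solution (ring_system G a g) x ->
    converges_to_set x (H2 G g).
Proof.
move=> x sol.
have rp := directed_ring_map ringG labelG.
have tx := filippov_ring_trajectory hn rp labelG a_gt0 g_incr sol.
have edE i (y : 'cV[R]_n) : edge_diff G i y = y (edge_tail G i) 0 - y i 0.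
  by rewrite edge_diffE labelG // ring_map_neq.
case: hcases => [[n2 g_odd]|[_ g0 [i0 special]]]; last first.
  have [|||w Hw] := ring_trajectory_cvg rp _ _ _ tx (i0 := i0).
  - by move=> i; rewrite g0 mulr0.
  (* A positive lower bound [c] would put [c / a i0] into the Filippov set of [g i0] at 0, which is
     [[set 0]]. *)
  - move=> c Hc; rewrite leNgt; apply/negP => c0.
    have : filippov1 (g i0) 0 (c / a i0).
      apply: filippov1_mem => z z0; last by rewrite ler_pdivrMr // mulrC;
        exact: Hc.
      apply: (@le_trans _ _ 0); first by rewrite -(g0 i0); apply: g_incr;
        exact: ltW.
      by apply: divr_ge0; exact: ltW.
    by rewrite special /= => /eqP; rewrite gt_eqF // divr_gt0.
  - move=> c Hc; rewrite leNgt; apply/negP => c0.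
    have : filippov1 (g i0) 0 (c / a i0).
      apply: filippov1_mem => z z0; first by rewrite ler_pdivlMr // mulrC;
        exact: Hc.
      apply: (@le_trans _ _ 0); last by rewrite -(g0 i0); apply: g_incr;
        exact: ltW.
      by rewrite ler_pdivrMr // mul0r ltW.
    by rewrite special /= => /eqP; rewrite lt_eqF // ltr_pdivrMr // mul0r.
  apply: (@converges_to_set_dist _ _ _ (fun=> \col_i w i)) => [_|i]; last first.
    have [cw _ _] := Hw i; rewrite -[X in _ --> X](subrr (w i)).
    by apply: cvgB => //; rewrite mxE; exact: cvg_cst.
  move=> i; rewrite edE !mxE; have [_ lo hi] := Hw i.
  apply: filippov1_mem => z.
    by move=> /lo; rewrite pmulr_rle0.
  by move=> /hi; rewrite pmulr_rge0.
subst n.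
pose i : 'I_2 := ord0; pose j : 'I_2 := ord_max.
have all_ij k : k = i \/ k = j.
  by case: k => [[|[|k]] // kl]; [left|right]; apply: val_inj.
have pi : edge_tail G i = j.
  by case: (all_ij (edge_tail G i)) (ring_map_neq i hn rp) => -> //;
    rewrite eqxx.
have pj : edge_tail G j = i.
  by case: (all_ij (edge_tail G j)) (ring_map_neq j hn rp) => -> //;
    rewrite eqxx.
have [||D [cD leD D0 HD]] := two_node_cvg pi pj _ _ tx.
- by move=> k y; rewrite g_odd mulrN.
- by move=> k y z yz; rewrite ler_pM2l //; exact: g_incr.
have g0 k : g k 0 = 0 by have := g_odd k 0; rewrite oppr0; lra.
have lo k z : z < D -> g k z <= 0.
  by move=> /HD[]; case: (all_ij k) => ->; rewrite !pmulr_rle0.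
have hi k z : D < z -> 0 <= g k z.
  by move=> Dz; rewrite -(g0 k); apply: g_incr; lra.
have memD k : filippov1 (g k) D 0.
  by apply: filippov1_mem => z; [exact: lo|exact: hi].
have memND k : filippov1 (g k) (- D) 0.
  apply: filippov1_mem => z hz; rewrite g_odd.
    by rewrite oppr_le0; apply: hi; lra.
  by rewrite oppr_ge0; apply: lo; lra.
(* The comparison point keeps the coordinate [i] of [x t] and has gap exactly [D] or [- D], with the
   sign of the current gap; both values are admissible by oddness. *)
pose d t : R := if 0 <= x t j 0 - x t i 0 then D else - D.
pose z t : 'cV[R]_2 := \col_k (if k == i then x t i 0 else x t i 0 + d t).
apply: (@converges_to_set_dist _ _ _ z) => [t k|k].
  have zi : z t i 0 = x t i 0 by rewrite mxE eqxx.
  have zj : z t j 0 = x t i 0 + d t by rewrite mxE.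
  rewrite edE; case: (all_ij k) => ->; rewrite ?pi ?pj zi zj /d.
    by rewrite addrAC subrr add0r; case: ifP.
  by rewrite opprD addNKr; case: ifP; rewrite ?opprK.
case: (all_ij k) => ->.
  rewrite (_ : (fun t => _) = fun=> 0); first exact: cvg_cst.
  by apply/funext => t; rewrite mxE eqxx subrr.
apply/cvgrPdist_lt => e e0.
have [T T0 HT] := cvg_pinfty_le cD e0.
apply: (@near_pinfty_intro _ _ T) => t Tt.
have := leD t (le_trans T0 Tt); have := HT t Tt.
rewrite mxE /= /d sub0r normrN; case: ifP => [h|/negbT];
  last rewrite -ltNge => h.
  by rewrite [`|x t j 0 - _|]ger0_norm // => /andP[_ h1] h2; rewrite ltr_norml;
    apply/andP; split; lra.
rewrite [`|x t j 0 - _|]ltr0_norm // => /andP[_ h1] h2.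
by rewrite ltr_norml; apply/andP; split; lra.
Qed.
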